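(* Let $Q=(q_k)_{k\ge1}$ be a sequence of integers with $q_k>1$, let $\varepsilon_k\in\{0,1,\dots,q_k-1\}$ for all $k$, and let $x=\sum_{k=1}^\infty\frac{\varepsilon_k}{q_1q_2\cdots q_k}$. Then $x$ is rational if and only if there exist integers $n\ge0$ and $m\ge1$ such that $$\sum_{k=n+1}^\infty\frac{\varepsilon_k}{q_1q_2\cdots q_k}=q_{n+1}q_{n+2}\cdots q_{n+m}\sum_{k=n+m+1}^\infty\frac{\varepsilon_k}{q_1q_2\cdots q_k}.$$ *)

(* Defs.v *)
From HB Require Import structures.
From mathcomp Require Import all_boot all_order all_algebra.
From mathcomp Require Import all_classical all_reals all_analysis.
Import numFieldNormedType.Exports.

Set Implicit Arguments.
Unset Strict Implicit.
Unset Printing Implicit Defensive.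

Import Order.TTheory GRing.Theory Num.Theory.
Local Open Scope ring_scope.

(* The k-th term e_k / (q_1 q_2 ... q_k) of a Cantor series, k >= 1.  Indices
   start at 1: the entries q 0 and e 0 are never used. *)
Definition cantor_term (R : realType) (q e : nat -> int) (k : nat) : R :=
  (e k)%:~R / (\prod_(1 <= j < k.+1) q j)%:~R.

(* Main.v *)
(** Write [P_n = q_1 ... q_n], let [T_n] be the tail of the series from index
    [n + 1] on, and [r_n = P_n T_n].  Then [P_n x - r_n] is an integer, and
    [0 <= r_n <= 1] because [e_k <= q_k - 1] makes the tail telescope.  The
    equation of the theorem says [r_n = r_(n+m)].  If it holds, then
    [(P_(n+m) - P_n) x] is an integer, so [x] is rational.  Conversely, if
    [x = a / b], then the [b r_n] are integers in [[0, b]], so two of them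
    coincide by the pigeonhole principle. *)
Require Import Defs.
From HB Require Import structures.
From mathcomp Require Import all_boot all_order all_algebra.
From mathcomp Require Import all_classical all_reals all_analysis.
From mathcomp Require Import ring lra.
Import numFieldNormedType.Exports.
Import Order.TTheory GRing.Theory Num.Theory.
Local Open Scope ring_scope.

(** Pigeonhole: the first [b + 2] indices share only [b + 1] possible values. *)
Lemma bounded_seq_repeats (b : nat) (f : nat -> nat) :
  (forall n, (f n <= b)%N) -> exists n m, (1 <= m)%N /\ f n = f (n + m)%N.
Proof.
move=> fb; pose g (i : 'I_b.+2) : 'I_b.+1 := inord (f i).
have : ~~ injectiveb g.
  by apply/negP => /injectiveP/leq_card; rewrite !card_ord ltnn.
move=> /injectivePn [i [j ij]] /(congr1 val); rewrite /= !inordK ?ltnS// => fij.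
wlog lt_ij : i j ij fij / (i < j)%N => [hwlog|].
  have [lt_ij|lt_ji|/val_inj eq_ij] := ltngtP i j; first exact: hwlog lt_ij.
  - by apply: hwlog lt_ji; [rewrite eq_sym|].
  - by rewrite eq_ij eqxx in ij.
by exists i, (j - i)%N; rewrite subn_gt0 subnKC ?(ltnW lt_ij).
Qed.

Definition cantor_prod (q : nat -> int) (n : nat) : int :=
  \prod_(1 <= j < n.+1) q j.

Definition cantor_tail (R : realType) (q e : nat -> int) (n : nat) : R :=
  \big[+%R/0]_(n.+1 <= k <oo) cantor_term R q e k.

(* The numerator of the [n]-th partial sum over the denominator
   [cantor_prod q n]. *)
Fixpoint cantor_num (q e : nat -> int) (n : nat) : int :=
  if n is n'.+1 then cantor_num q e n' * q n + e n else 0.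

Lemma cantor_prodS q n : cantor_prod q n.+1 = cantor_prod q n * q n.+1.
Proof. by rewrite /cantor_prod big_nat_recr. Qed.

Lemma cantor_prodD q n m :
  cantor_prod q (n + m) =
    cantor_prod q n * \prod_(n.+1 <= j < (n + m).+1) q j.
Proof. by rewrite /cantor_prod -big_cat_nat//= ltnS leq_addr. Qed.

Section CantorSeries.
Context (R : realType) (q e : nat -> int).
Hypothesis hq : forall k : nat, (1 <= k)%N -> 1 < q k.
Hypothesis he : forall k : nat, (1 <= k)%N -> 0 <= e k <= q k - 1.

Local Notation P := (cantor_prod q).
Local Notation term := (cantor_term R q e).
Local Notation tail := (cantor_tail R q e).

Lemma cantor_prod_gt0 n : 0 < P n.
Proof.
elim: n => [|n IHn]; first by rewrite /cantor_prod big_nil.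
by rewrite cantor_prodS mulr_gt0// (lt_trans ltr01)// hq.
Qed.

Lemma cantor_prod_lt n m : (n < m)%N -> P n < P m.
Proof.
apply: (homo_ltn lt_trans) => k.
by rewrite cantor_prodS ltr_pMr ?cantor_prod_gt0// hq.
Qed.

Lemma cantor_prodR_gt0 n : 0 < (P n)%:~R :> R.
Proof. by rewrite ltr0z cantor_prod_gt0. Qed.

Lemma cantor_term_ge0 k : (1 <= k)%N -> 0 <= term k.
Proof.
move=> k1; have /andP[e0 _] := he _ k1.
by rewrite divr_ge0// ler0z// ltW// cantor_prod_gt0.
Qed.

(** The right-hand side equals [(q k.+1 - 1) / P k.+1], the term with the largest admissible
    digit. *)
Lemma cantor_term_le k :
  term k.+1 <= ((P k)%:~R)^-1 - ((P k.+1)%:~R)^-1.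
Proof.
have /andP[_ eq1] := he k.+1 isT.
have P0 := cantor_prodR_gt0 k.
have q0 : 0 < (q k.+1)%:~R :> R by rewrite ltr0z (lt_trans ltr01)// hq.
have -> : term k.+1 = (e k.+1)%:~R / (P k.+1)%:~R by [].
rewrite cantor_prodS intrM.
have -> : ((P k)%:~R)^-1 - ((P k)%:~R * (q k.+1)%:~R)^-1 =
    (q k.+1 - 1)%:~R / ((P k)%:~R * (q k.+1)%:~R) :> R.
  by rewrite intrB; field; rewrite !gt_eqF.
by rewrite ler_pM2r ?invr_gt0 ?mulr_gt0// ler_int.
Qed.

Lemma cantor_sum_le n N :
  \sum_(n.+1 <= k < N) term k <= ((P n)%:~R)^-1.
Proof.
have [Nn|nN] := leqP N n.+1.
  by rewrite big_geq// invr_ge0 ltW// cantor_prodR_gt0.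
case: N nN => // N; rewrite ltnS => nN.
rewrite big_add1 /=.
(* The reciprocals decrease, so they are negated to fit the [f k.+1 - f k] form of the telescoping
   lemma. *)
apply: (@le_trans _ _ (\sum_(n <= k < N)
    (- ((P k.+1)%:~R)^-1 - - ((P k)%:~R)^-1))).
  by apply: ler_sum => k _; rewrite opprK addrC cantor_term_le.
rewrite (telescope_sumr (fun k => - ((P k)%:~R)^-1)); last exact: ltnW.
by rewrite opprK gerDr oppr_le0 invr_ge0 ltW// cantor_prodR_gt0.
Qed.

Lemma cantor_sum_ge0 n N : 0 <= \sum_(n.+1 <= k < N) term k.
Proof.
rewrite big_nat_cond; apply: sumr_ge0 => k /andP[/andP[nk _] _].
by rewrite cantor_term_ge0// (leq_trans _ nk).
Qed.

(** An infinite sum is a [lim], which can be estimated or split only once convergence is known; here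
    the partial sums are monotone and bounded. *)
Lemma is_cvg_cantor_sum n :
  cvgn (fun N => \sum_(n.+1 <= k < N) term k).
Proof.
apply: nondecreasing_is_cvgn; last first.
  by exists ((P n)%:~R)^-1 => _ [N _ <-]; apply: cantor_sum_le.
apply/nondecreasing_seqP => N.
have [Nn|nN] := leqP N n; first by rewrite !big_geq// leqW.
by rewrite big_nat_recr//= lerDl cantor_term_ge0// (leq_trans _ nN).
Qed.

Lemma cantor_tail_bounds n : 0 <= (P n)%:~R * tail n <= 1.
Proof.
have P0 := cantor_prodR_gt0 n.
have cv := is_cvg_cantor_sum n.
rewrite pmulr_rge0// -ler_pdivlMl// mulr1; apply/andP; split.
- by apply: limr_ge => //; apply: nearW => N; apply: cantor_sum_ge0.
- by apply: limr_le => //; apply: nearW => N; apply: cantor_sum_le.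
Qed.

Lemma cantor_tail_split n : tail 0 = \sum_(1 <= k < n.+1) term k + tail n.
Proof.
apply: cvg_lim => //.
apply: (@cvg_trans _ ((fun N => \sum_(1 <= k < n.+1) term k +
    \sum_(n.+1 <= k < N) term k) @ \oo)%classic).
  (* The range can be cut at [n.+1] only when [n.+1 <= N], hence an eventual equality. *)
  apply: near_eq_cvg; near=> N.
  rewrite -big_cat_nat//=; near: N; exact: nbhs_infty_ge.
by apply: cvgD; [exact: cvg_cst|exact: is_cvg_cantor_sum].
Unshelve. all: by end_near. Qed.

Lemma cantor_num_sum n :
  (P n)%:~R * \sum_(1 <= k < n.+1) term k = (cantor_num q e n)%:~R.
Proof.
elim: n => [|n IHn]; first by rewrite big_nil mulr0.
have Pn0 := cantor_prodR_gt0 n.+1.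
rewrite big_nat_recr//= mulrDr {1}cantor_prodS intrM mulrAC IHn.
by rewrite [term _]mulrC mulVKf ?gt_eqF// intrD intrM.
Qed.

Lemma cantor_scaled_tail n :
  (P n)%:~R * tail n = (P n)%:~R * tail 0 - (cantor_num q e n)%:~R.
Proof. by rewrite (cantor_tail_split n) mulrDr cantor_num_sum addrC addKr. Qed.

(** The two sides differ by the nonzero factor [P n], which completes the product to [P (n + m)]. *)
Lemma cantor_tail_eq n m :
  tail n = (\prod_(n.+1 <= j < (n + m).+1) q j)%:~R * tail (n + m) <->
  (P n)%:~R * tail n = (P (n + m))%:~R * tail (n + m).
Proof.
rewrite cantor_prodD intrM -mulrA; split=> [<-//|].
by apply: mulfI; rewrite gt_eqF// cantor_prodR_gt0.
Qed.

End CantorSeries.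

Theorem theorem3 (R : realType) (q e : nat -> int)
    (hq : forall k : nat, (1 <= k)%N -> 1 < q k)
    (he : forall k : nat, (1 <= k)%N -> 0 <= e k <= q k - 1)
    (x : R) (hx : x = \big[+%R/0]_(1 <= k <oo) cantor_term R q e k) :
  rational x <->
  exists n m : nat, (1 <= m)%N /\
    \big[+%R/0]_(n.+1 <= k <oo) cantor_term R q e k =
      (\prod_(n.+1 <= j < (n + m).+1) q j)%:~R *
        \big[+%R/0]_((n + m).+1 <= k <oo) cantor_term R q e k.
Proof.
have scaled n : (cantor_prod q n)%:~R * cantor_tail R q e n =
    (cantor_prod q n)%:~R * x - (cantor_num q e n)%:~R.
  by rewrite hx; apply: cantor_scaled_tail.
split.
- move=> [r _]; have [a b _] := ratP r => rx.
  have bx : b.+1%:R * x = a%:~R.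
    by rewrite -rx fmorph_div/= ratr_int ratr_nat mulrC divfK// pnatr_eq0.
  (* With [x = a / b.+1], this is [b.+1] times the scaled tail, written as an integer. *)
  pose c n := cantor_prod q n * a - b.+1%:Z * cantor_num q e n.
  have cE n : (c n)%:~R =
      b.+1%:R * ((cantor_prod q n)%:~R * cantor_tail R q e n).
    by rewrite scaled intrB !intrM -bx; ring.
  have c_bounds n : 0 <= c n <= b.+1%:Z.
    have /andP[r0 r1] := cantor_tail_bounds R q e hq he n.
    by rewrite -(ler0z R) -(ler_int R) cE mulr_ge0//= ler_piMr.
  (* Absolute values move [c] to [nat]; they lose nothing because [c n] is nonnegative. *)
  have [|n [m [m0 cnm]]] := bounded_seq_repeats b.+1 (fun n => `|c n|%N).
    by move=> n; have /andP[c0 c1] := c_bounds n; rewrite -lez_nat gez0_abs.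
  exists n, m; split=> //.
  apply/(cantor_tail_eq R q e hq).
  have /andP[cn0 _] := c_bounds n; have /andP[cm0 _] := c_bounds (n + m)%N.
  move/(congr1 Posz): cnm; rewrite !gez0_abs// => /(congr1 (intr : int -> R)).
  by rewrite !cE; apply: mulfI; rewrite pnatr_eq0.
- move=> [n [m [m0]]] /(cantor_tail_eq R q e hq); rewrite !scaled => eq_r.
  (* Here [1 <= m] enters: it makes the denominator of the witness below nonzero. *)
  have Plt : cantor_prod q n < cantor_prod q (n + m).
    by apply: cantor_prod_lt; rewrite // -addn1 leq_add2l.
  (* The witness is the solution of [eq_r], a linear equation in [x]. *)
  exists ((cantor_num q e (n + m) - cantor_num q e n)%:~R /
          (cantor_prod q (n + m) - cantor_prod q n)%:~R) => //.
  rewrite fmorph_div/= !ratr_int; apply: (canLR (mulfK _)).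
    by rewrite intr_eq0 subr_eq0 gt_eqF.
  by rewrite !intrB mulrC; lra.
Qed.
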